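(* Let $E$ and $F$ be Banach spaces, $\mathcal A$ a Banach operator ideal and $T\in\mathcal L(E,F)$. Suppose that there are Banach spaces $G_1,G_2$, Lipschitz maps $f_1\colon E\to G_1$ and $f_2\colon G_2\to F$, and $R\in\mathcal A(G_1,G_2)$ such that $T=f_2\circ R\circ f_1$. If $\mathcal A$ is a maximal Banach operator ideal with the property that for every finite-dimensional Banach space $M$ and every Banach space $H$, every Lipschitz function $f\in\mathcal A\circ\mathrm{Lip}_0(M,H)$ has a point of Gateaux differentiability in $M$, then $T\in\mathcal A(E,F)$.
   Context: Banach spaces are real; $\mathcal L(E,F)$ is the space of bounded linear operators. A Banach operator ideal $\mathcal A$ is a Banach ideal of bounded linear operators in the sense of Pietsch, with norm $\|\cdot\|_{\mathcal A}$. Its maximal hull $\mathcal A^{\max}$ consists of those $T\in\mathcal L(E,F)$ with $\|T\|_{\mathcal A^{\max}}:=\sup\|q_L^F\circ T\circ\iota_M^E\|_{\mathcal A}<\infty$, over all finite-dimensional subspaces $M\subset E$ (inclusion $\iota_M^E\colon M\to E$) and closed finite-codimensional subspaces $L\subset F$ (quotient map $q_L^F\colon F\to F/L$); $\mathcal A$ is maximal if $\mathcal A=\mathcal A^{\max}$ with equal norms. $\mathrm{Lip}_0(E,G)$ is the set of Lipschitz maps $E\to G$ vanishing at $0$. $\mathcal A\circ\mathrm{Lip}_0(M,H)$ is the set of maps $f=S\circ g$ with $G$ a Banach space, $g\in\mathrm{Lip}_0(M,G)$ and $S\in\mathcal A(G,H)$. A map $f\colon M\to H$ between Banach spaces is Gateaux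 differentiable at $x_0$ if there is $Df(x_0)\in\mathcal L(M,H)$ with $Df(x_0)(x)=\lim_{t\to0}\frac{f(x_0+tx)-f(x_0)}{t}$ for every $x\in M$. *)

(* Defs.v *)
(* Real Banach spaces are [completeNormedModType R] with [R : realType].
   Operators and Lipschitz maps are plain functions with predicates. *)
From HB Require Import structures.
From mathcomp Require Import all_boot all_order all_algebra.
From mathcomp Require Import generic_quotient ring_quotient.
From mathcomp Require Import all_classical all_reals.
From mathcomp Require Import ereal topology normedtype sequences.

Set Implicit Arguments.
Unset Strict Implicit.
Unset Printing Implicit Defensive.

Import Order.TTheory GRing.Theory Num.Theory.
Import numFieldNormedType.Exports.

Local Open Scope classical_set_scope.
Local Open Scope ring_scope.

Definition finite_dim (R : realType) (V : lmodType R) : Prop :=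
  exists (n : nat) (b : 'I_n -> V),
    forall v, exists c : 'I_n -> R, v = \sum_(i < n) c i *: b i.

Record closedSubspace (R : realType) (E : normedModType R) := ClosedSubspace {
  csub :> {pred E};
  csub_submod : submod_closed csub;
  csub_closed : closed [set x | x \in csub] }.

HB.instance Definition _ (R : realType) (E : normedModType R)
    (M : closedSubspace E) :=
  GRing.isSubmodClosed.Build R E (csub M) (csub_submod M).

Section Subspace.
Variables (R : realType) (E : normedModType R) (M : closedSubspace E).

Record sub_space : Type := SubSpace {
  sub_incl :> E;
  sub_inclP : sub_incl \in csub M }.

HB.instance Definition _ := [isSub for sub_incl].
HB.instance Definition _ := [Choice of sub_space by <:].
HB.instance Definition _ := [SubChoice_isSubLmodule of sub_space by <:].

Definition sub_norm (x : sub_space) : R := `|sub_incl x|.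

Let sub_normD x y : sub_norm (x + y) <= sub_norm x + sub_norm y.
Proof. exact: ler_normD. Qed.

Let sub_normZ (l : R) x : sub_norm (l *: x) = `|l| * sub_norm x.
Proof. exact: normrZ. Qed.

Let sub_norm0_eq0 x : sub_norm x = 0 -> x = 0.
Proof. by move=> /normr0_eq0 x0; apply: val_inj. Qed.

HB.instance Definition _ :=
  Lmodule_isNormed.Build R sub_space sub_normD sub_normZ sub_norm0_eq0.

End Subspace.

Section SubspaceComplete.
Variables (R : realType) (E : completeNormedModType R) (M : closedSubspace E).
Local Notation sub_space := (sub_space M).

Let sub_complete (F : set_system sub_space) :
  ProperFilter F -> cauchy F -> cvg F.
Proof.
move=> FF /cauchyP Fc.
have cG : cauchy (@sub_incl _ _ M @ F).
  apply: cauchy_exP => e e0; have [x Fx] := Fc e e0.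
  exists (sub_incl x).
  suff : F (@sub_incl _ _ M @^-1` ball (sub_incl x) e) by [].
  by apply: filterS Fx => y; rewrite -!ball_normE.
have cvG : cvg (@sub_incl _ _ M @ F) by exact: cauchy_cvg cG.
have [l Gl] := (cvg_ex _).1 cvG.
have lM : l \in csub M.
  apply: (@csub_closed _ _ M) => B Bl.
  have /filter_ex[x Bx] : F (@sub_incl _ _ M @^-1` B) by exact: Gl.
  by exists (sub_incl x); split => //; exact: sub_inclP.
apply/cvg_ex; exists (SubSpace lM : sub_space).
apply/cvgrPdist_lt => e e0.
by have /cvgrPdist_lt/(_ e e0) := Gl.
Qed.

HB.instance Definition _ := Uniform_isComplete.Build sub_space sub_complete.

End SubspaceComplete.

Section Quotient.
Variables (R : realType) (F : normedModType R) (L : closedSubspace F).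

Definition quot_space : Type := Quotient.quot (csub L).

HB.instance Definition _ := GRing.Zmodule.on quot_space.
HB.instance Definition _ := EqQuotient.on quot_space.

Definition quot_map (x : F) : quot_space := (\pi_quot_space x)%qT.

Lemma quot_map_eq x y : quot_map x = quot_map y <-> x - y \in csub L.
Proof.
rewrite /quot_map; split => [xy|].
  by rewrite (Quotient.idealrBE (csub L)); apply/eqP.
by rewrite (Quotient.idealrBE (csub L)) => /eqP.
Qed.

Lemma quot_mapD x y : quot_map (x + y) = quot_map x + quot_map y.
Proof. exact: (Quotient.pi_add (csub L)). Qed.

Lemma quot_map_repr (x : quot_space) : quot_map (repr x) = x.
Proof. exact: reprK. Qed.

Definition quot_scale (a : R) (x : quot_space) : quot_space :=
  quot_map (a *: repr x).

Let quot_scaleE a x : quot_scale a (quot_map x) = quot_map (a *: x).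
Proof.
apply/quot_map_eq; rewrite -scalerBr rpredZ//.
by apply/quot_map_eq; rewrite quot_map_repr.
Qed.

Let quot_scaleA a b x : quot_scale a (quot_scale b x) = quot_scale (a * b) x.
Proof. by rewrite -(quot_map_repr x) !quot_scaleE scalerA. Qed.

Let quot_scale1 x : quot_scale 1 x = x.
Proof. by rewrite -(quot_map_repr x) !quot_scaleE scale1r. Qed.

Let quot_scaleDr a x y :
  quot_scale a (x + y) = quot_scale a x + quot_scale a y.
Proof.
rewrite -(quot_map_repr x) -(quot_map_repr y) -quot_mapD !quot_scaleE.
by rewrite scalerDr quot_mapD.
Qed.

Let quot_scaleDl x a b :
  quot_scale (a + b) x = quot_scale a x + quot_scale b x.
Proof. by rewrite -(quot_map_repr x) !quot_scaleE scalerDl quot_mapD. Qed.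

HB.instance Definition _ := GRing.Zmodule_isLmodule.Build R quot_space
  quot_scaleA quot_scale1 quot_scaleDr quot_scaleDl.

Lemma quot_mapZ a x : quot_map (a *: x) = a *: quot_map x.
Proof. by rewrite -quot_scaleE. Qed.

Definition quot_norm (x : quot_space) : R :=
  inf [set `|y| | y in [set y | quot_map y = x]].

Let quot_norm_has_inf x : has_inf [set `|y| | y in [set y | quot_map y = x]].
Proof.
split; first by exists `|repr x|, (repr x) => //; exact: quot_map_repr.
by exists 0 => _ [y _ <-].
Qed.

Let quot_norm_le y : quot_norm (quot_map y) <= `|y|.
Proof. by apply: ge_inf; [exact: (quot_norm_has_inf _).2|exists y]. Qed.

Let quot_norm_ge0 x : 0 <= quot_norm x.
Proof.
by apply: lb_le_inf; [exact: (quot_norm_has_inf _).1|move=> _ [y _ <-]].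
Qed.

Let quot_norm_lift x e : 0 < e ->
  exists2 y, quot_map y = x & `|y| < quot_norm x + e.
Proof.
move=> e0; have [_ [y yx <-] ye] := inf_adherent e0 (quot_norm_has_inf x).
by exists y.
Qed.

Let quot_normD x y : quot_norm (x + y) <= quot_norm x + quot_norm y.
Proof.
apply/ler_addgt0Pr => e e0.
have e2 : 0 < e / 2 by rewrite divr_gt0.
have [a ax ae] := quot_norm_lift x e2.
have [b bx be] := quot_norm_lift y e2.
rewrite -ax -bx -quot_mapD (le_trans (quot_norm_le _))//.
rewrite (le_trans (ler_normD _ _))// ltW// (lt_le_trans (ltrD ae be))//.
by rewrite ax bx addrACA -splitr.
Qed.

Let quot_normZ_le (l : R) x : quot_norm (l *: x) <= `|l| * quot_norm x.
Proof.
apply/ler_addgt0Pr => e e0.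
have d0 : 0 < e / (`|l| + 1) by rewrite divr_gt0// ltr_wpDl.
have [a ax ae] := quot_norm_lift x d0.
rewrite -{1}ax -quot_mapZ (le_trans (quot_norm_le _))// normrZ.
rewrite (le_trans (ler_wpM2l (normr_ge0 l) (ltW ae)))// mulrDr lerD2l//.
by rewrite mulrCA ger_pMr// ler_pdivrMr ?mul1r ?lerDl//.
Qed.

Let quot_normZ (l : R) x : quot_norm (l *: x) = `|l| * quot_norm x.
Proof.
apply/eqP; rewrite eq_le quot_normZ_le/=.
have [->|l0] := eqVneq l 0; first by rewrite normr0 mul0r.
have := quot_normZ_le l^-1 (l *: x).
rewrite scalerA mulVf// scale1r normfV.
by rewrite -ler_pdivrMl ?invr_gt0 ?normr_gt0// invrK.
Qed.

Let quot_norm0_eq0 x : quot_norm x = 0 -> x = 0.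
Proof.
move=> x0; rewrite -(quot_map_repr x).
have <- : quot_map 0 = 0 by apply: (addIr (quot_map 0)); rewrite -quot_mapD !add0r.
apply/quot_map_eq; rewrite subr0.
apply: (@csub_closed _ _ L) => B /nbhs_ballP[e /= e0 eB].
have [y yx] := quot_norm_lift x e0; rewrite x0 add0r => ye.
exists (repr x - y); split => /=.
  by apply/quot_map_eq; rewrite quot_map_repr.
apply: eB; rewrite -ball_normE /= opprB addrC subrK//.
Qed.

HB.instance Definition _ :=
  Lmodule_isNormed.Build R quot_space quot_normD quot_normZ quot_norm0_eq0.

Lemma quot_map_norm_le y : `|quot_map y| <= `|y|.
Proof. exact: quot_norm_le. Qed.

Lemma quot_map_lift (x : quot_space) e : 0 < e ->
  exists2 y, quot_map y = x & `|y| < `|x| + e.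
Proof. exact: quot_norm_lift. Qed.

End Quotient.

Section QuotientComplete.
Variables (R : realType) (F : completeNormedModType R) (L : closedSubspace F).
Local Notation quot_space := (quot_space L).
Local Notation quot_map := (@quot_map _ _ L).

Let quot_mapB x y : quot_map (x - y) = quot_map x - quot_map y.
Proof. by rewrite quot_mapD -scaleN1r quot_mapZ scaleN1r. Qed.

Let quot_complete (Phi : set_system quot_space) :
  ProperFilter Phi -> cauchy Phi -> cvg Phi.
Proof.
move=> PF /cauchyP Fc.
have h0 n : 0 < (2^-1 : R) ^+ n by rewrite exprn_gt0.
have /choice[x Fx] n : exists x, Phi (ball x ((2^-1 : R) ^+ n)) by exact: Fc.
have xS n : `|x n.+1 - x n| < 2 * (2^-1 : R) ^+ n.
  have [z []] := filter_ex (filterI (Fx n) (Fx n.+1)).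
  rewrite -!ball_normE /= => xz xz'.
  have -> : x n.+1 - x n = (x n.+1 - z) - (x n - z).
    by rewrite opprB addrA subrK.
  rewrite (le_lt_trans (ler_normB _ _))// mulr_natl mulr2n ltrD//.
  by rewrite (lt_le_trans xz')// exprS ger_pMl// invf_le1// ler1n.
have dP n : exists d, quot_map d = x n.+1 - x n /\
    `|d| <= 4 * (2^-1 : R) ^+ n.
  have [d dx de] := quot_map_lift (x n.+1 - x n) (h0 n).
  exists d; split => //; apply/ltW/(lt_trans de).
  rewrite -ltrBrDr (lt_trans (xS n))// ltrBrDr -[X in _ + X]mul1r -mulrDl.
  by rewrite ltr_pM2r// natr1 ltr_nat.
have [d /all_and2[dx dle]] := choice dP.
have cd : cvgn (series d).
  apply: normed_cvg.
  apply: (@series_le_cvg _ (fun n => `|d n|) (geometric 4 (2^-1 : R))) => //.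
  - by move=> n; rewrite /geometric /= mulr_ge0// ltW.
  - apply: is_cvg_geometric_series; rewrite ger0_norm ?invf_lt1 ?ltr1n//.
have sd n : quot_map (series d n) = x n - x 0%N.
  elim: n => [|n IH].
    by rewrite /series /= big_geq// subrr -(subrr 0) quot_mapB subrr.
  by rewrite seriesSr quot_mapD IH dx addrC addrA subrK.
pose l := quot_map (limn (series d)) + x 0%N.
apply/cvg_ex; exists l; apply/cvgrPdist_lt => e e0.
have e2 : 0 < e / 2 by rewrite divr_gt0.
have : \forall n \near \oo, `|limn (series d) - series d n| < e / 2.
  exact: (cvgrPdist_lt _ _).1 cd _ e2.
have : \forall n \near \oo, (2^-1 : R) ^+ n < e / 2.
  have h1 : `|2^-1 : R| < 1 by rewrite ger0_norm ?invf_lt1 ?ltr1n.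
  have he : \forall n \near \oo, `|0 - (2^-1 : R) ^+ n| < e / 2.
    exact: (cvgrPdist_lt _ _).1 (cvg_expr h1) _ e2.
  by apply: filterS he => n; rewrite sub0r normrN ger0_norm// ltW.
move=> H1 H2; have [n [n1 n2]] := filter_ex (filterI H1 H2).
apply: filterS (Fx n) => z; rewrite -ball_normE /= => xz.
have -> : l - z = (l - x n) + (x n - z) by rewrite addrA subrK.
rewrite (le_lt_trans (ler_normD _ _))// (splitr e) ltrD//; last exact: lt_trans n1.
have -> : l - x n = quot_map (limn (series d) - series d n).
  by rewrite quot_mapB sd /l opprB addrA.
exact: le_lt_trans (quot_map_norm_le _ _) n2.
Qed.

HB.instance Definition _ := Uniform_isComplete.Build quot_space quot_complete.

End QuotientComplete.

(* Finite-dimensional subspaces are closed: if [W] is closed then [W + R v] is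
   the preimage under [E -> E / W] of a line. *)
Section FiniteDimClosed.
Variables (R : realType).

Lemma quot_map_continuous (F : normedModType R) (L : closedSubspace F) :
  continuous (@quot_map _ _ L).
Proof.
move=> x; apply/cvgrPdist_lt => e e0.
apply/nbhs_ballP; exists e => // y; rewrite -ball_normE /= => xy.
suff -> : quot_map L x - quot_map L y = quot_map L (x - y).
  exact: le_lt_trans (quot_map_norm_le _ _) xy.
by rewrite quot_mapD -[in RHS]scaleN1r quot_mapZ scaleN1r.
Qed.

Let line (V : normedModType R) (v : V) : set V := range (fun a : R => a *: v).

Let line_closed (V : normedModType R) (v : V) : closed (line v).
Proof.
have [->|v0] := eqVneq v 0.
  suff -> : line 0 = [set 0 : V].
    exact: (compact_closed (@norm_hausdorff _ _) (@compact_set1 _ _)).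
  by apply/seteqP; split => [_ [a _ <-]|_ ->]; [rewrite scaler0|exists 0; rewrite ?scaler0].
have nv : 0 < `|v| by rewrite normr_gt0.
move=> y cy; pose K := (`|y| + 1) / `|v|.
have cK : compact ((fun a : R => a *: v) @` `[- K, K]).
  apply: continuous_compact; last exact: segment_compact.
  by apply: continuous_subspaceT => a; exact: scalel_continuous.
suff [a _ <-] : ((fun a : R => a *: v) @` `[- K, K]) y by exists a.
apply: (compact_closed (@norm_hausdorff _ _) cK) => B By.
have [_ [[a _ <-] [Ba ya]]] := cy _ (filterI By (nbhsx_ballx y 1 ltr01)).
exists (a *: v); split => //; exists a => //=.
rewrite in_itv /= -ler_norml /K ler_pdivlMr// -normrZ.
move: ya; rewrite -ball_normE /= => ya.
have -> : a *: v = y - (y - a *: v) by rewrite opprB addrC subrK.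
by rewrite (le_trans (ler_normB _ _))// lerD2l ltW.
Qed.

Let span (V : normedModType R) (b : nat -> V) n : set V :=
  [set v | exists c : nat -> R, v = \sum_(i < n) c i *: b i].

Let span_submod (V : normedModType R) (b : nat -> V) n :
  submod_closed [pred v | v \in span b n].
Proof.
split.
  rewrite !inE; exists (fun=> 0).
  by rewrite big1// => i _; rewrite scale0r.
move=> a u v; rewrite !inE => -[c ->] [d ->]; exists (fun i => a * c i + d i).
rewrite scaler_sumr -big_split/=; apply: eq_bigr => i _.
by rewrite scalerA scalerDl.
Qed.

Let span_closed (V : normedModType R) (b : nat -> V) n : closed (span b n).
Proof.
elim: n => [|n IH].
  suff -> : span b 0 = [set 0].
    exact: (compact_closed (@norm_hausdorff _ _) (@compact_set1 _ _)).
  apply/seteqP; split => [_ [c ->]|_ ->]; first by rewrite big_ord0.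
  by exists (fun=> 0); rewrite big_ord0.
have IH' : closed [set x | x \in [pred v | v \in span b n]].
  suff -> : [set x | x \in [pred v | v \in span b n]] = span b n by [].
  by apply/seteqP; split => x; rewrite /= inE.
pose L := ClosedSubspace (span_submod b n) IH'.
suff -> : span b n.+1 = quot_map L @^-1` line (quot_map L (b n)).
  by apply: preimage_closed; [move=> x _; exact: quot_map_continuous|exact: line_closed].
apply/seteqP; split => v /=.
  move=> [c ->]; exists (c n) => //; rewrite -quot_mapZ big_ord_recr/=.
  apply/quot_map_eq; rewrite opprD addrCA subrr addr0 -sumrN !inE.
  exists (fun i => - c i); apply: eq_bigr => i _; by rewrite scaleNr.
move=> [a _]; rewrite -quot_mapZ => /esym/quot_map_eq; rewrite !inE => -[c h].
exists (fun i => if i == n then a else c i).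
rewrite big_ord_recr/= eqxx -[LHS](subrK (a *: b n)) h; congr (_ + _).
by apply: eq_bigr => i _; rewrite ltn_eqF.
Qed.

Lemma finite_span_closed (V : normedModType R) n (b : 'I_n -> V) :
  closed [set v | exists c : 'I_n -> R, v = \sum_(i < n) c i *: b i].
Proof.
case: n b => [|n] b.
  suff -> : [set v | exists c : 'I_0 -> R, v = \sum_(i < 0) c i *: b i] =
      span (fun=> 0 : V) 0 by exact: span_closed.
  by apply/seteqP; split => v [c ->]; [exists (fun=> 0)|exists (fun=> 0)]; rewrite !big_ord0.
suff -> : [set v | exists c : 'I_n.+1 -> R, v = \sum_(i < n.+1) c i *: b i] =
    span (fun i => b (inord i)) n.+1 by exact: span_closed.
apply/seteqP; split => v [c ->].
  by exists (fun i => c (inord i)); apply: eq_bigr => i _; rewrite inord_val.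
by exists (fun i => c i); apply: eq_bigr => i _; rewrite inord_val.
Qed.

End FiniteDimClosed.

Record fdSubspace (R : realType) (E : normedModType R) := FdSubspace {
  fdsub : {pred E};
  fdsub_submod : submod_closed fdsub;
  fdsub_span : exists (n : nat) (b : 'I_n -> E), forall v,
    v \in fdsub <-> exists c : 'I_n -> R, v = \sum_(i < n) c i *: b i }.

Lemma fdsub_closed (R : realType) (E : normedModType R) (M : fdSubspace E) :
  closed [set x | x \in fdsub M].
Proof.
have [n [b bM]] := fdsub_span M.
suff -> : [set x | x \in fdsub M] =
    [set v | exists c : 'I_n -> R, v = \sum_(i < n) c i *: b i].
  exact: finite_span_closed.
by apply/seteqP; split => v /bM.
Qed.

Definition fd_closedSubspace (R : realType) (E : normedModType R)
    (M : fdSubspace E) : closedSubspace E :=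
  ClosedSubspace (fdsub_submod M) (@fdsub_closed R E M).
Coercion fd_closedSubspace : fdSubspace >-> closedSubspace.

Definition bounded_linear (R : realType) (E F : normedModType R)
    (T : E -> F) : Prop :=
  linear T /\ exists C : R, forall x, `|T x| <= C * `|x|.

Definition op_norm (R : realType) (E F : normedModType R) (T : E -> F) : R :=
  sup [set `|T x| | x in [set x | `|x| <= 1]].

(* Pietsch's axioms. Closure of each component under scalars, homogeneity and
   definiteness of the ideal norm follow from the multiplication axioms.
   [ideal_norm] is total; its values outside the ideal are irrelevant. *)
Record banachIdeal (R : realType) := BanachIdeal {
  ideal_mem : forall E F : completeNormedModType R, set (E -> F);
  ideal_norm : forall E F : completeNormedModType R, (E -> F) -> R;
  ideal_bounded : forall (E F : completeNormedModType R) (T : E -> F),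
    ideal_mem T -> bounded_linear T;
  ideal_id : ideal_mem (@idfun R);
  ideal_add : forall (E F : completeNormedModType R) (S T : E -> F),
    ideal_mem S -> ideal_mem T -> ideal_mem (S \+ T);
  ideal_comp : forall (E0 E F F0 : completeNormedModType R)
      (S : F -> F0) (T : E -> F) (U : E0 -> E),
    bounded_linear S -> ideal_mem T -> bounded_linear U ->
    ideal_mem (S \o T \o U);
  ideal_norm_ge0 : forall (E F : completeNormedModType R) (T : E -> F),
    ideal_mem T -> 0 <= ideal_norm T;
  ideal_norm_id : ideal_norm (@idfun R) = 1;
  ideal_norm_add : forall (E F : completeNormedModType R) (S T : E -> F),
    ideal_mem S -> ideal_mem T ->
    ideal_norm (S \+ T) <= ideal_norm S + ideal_norm T;
  ideal_norm_comp : forall (E0 E F F0 : completeNormedModType R)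
      (S : F -> F0) (T : E -> F) (U : E0 -> E),
    bounded_linear S -> ideal_mem T -> bounded_linear U ->
    ideal_norm (S \o T \o U) <= op_norm S * ideal_norm T * op_norm U;
  ideal_complete : forall (E F : completeNormedModType R)
      (u : nat -> E -> F),
    (forall n, ideal_mem (u n)) ->
    (forall e : R, 0 < e -> exists N, forall m n, (N <= m)%N -> (N <= n)%N ->
      ideal_norm (u m \- u n) < e) ->
    exists2 T : E -> F, ideal_mem T &
      (fun n => ideal_norm (u n \- T)) @ \oo --> (0 : R) }.

Section MaximalHull.
Variables (R : realType) (A : banachIdeal R).
Variables (E F : completeNormedModType R).

Definition max_hull_norm (T : E -> F) : \bar R :=
  ereal_sup [set x | exists (M : fdSubspace E) (L : closedSubspace F),
    finite_dim (quot_space L) /\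
    x = (ideal_norm A (@quot_map _ _ L \o T \o @sub_incl _ _ M))%:E].

Definition max_hull (T : E -> F) : Prop :=
  bounded_linear T /\ (max_hull_norm T < +oo)%E.

End MaximalHull.

Definition maximal_ideal (R : realType) (A : banachIdeal R) : Prop :=
  forall (E F : completeNormedModType R),
    (forall T : E -> F, ideal_mem A T <-> max_hull A T) /\
    (forall T : E -> F, ideal_mem A T ->
       (ideal_norm A T)%:E = max_hull_norm A T).

Definition Lip0 (R : realType) (E G : normedModType R) (g : E -> G) : Prop :=
  lipschitz g /\ g 0 = 0.

Definition ideal_Lip0 (R : realType) (A : banachIdeal R)
    (M H : completeNormedModType R) (f : M -> H) : Prop :=
  exists (G : completeNormedModType R) (g : M -> G) (S : G -> H),
    [/\ Lip0 g, ideal_mem A S & f = S \o g].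

Definition gateaux_differentiable (R : realType) (M H : normedModType R)
    (f : M -> H) (x0 : M) : Prop :=
  exists D : M -> H, bounded_linear D /\
    forall x, t^-1 *: (f (x0 + t *: x) - f x0) @[t --> (0 : R)^'] --> D x.

(* Main.v *)
(* Fix finite-dimensional [M] in [E] and a finite-codimensional [L] in [F]. On
   [M] the map [S \o f1] (normalised at 0) has a Gateaux derivative [D] at some
   [x0].  It is the limit of [S \o g_t], where [g_t] are the difference quotients
   of [f1]; averaging [g_t] over large boxes makes it almost additive and keeps
   its Lipschitz constant, so [D] is a limit of operators [S \o U] with [U] linear
   and [`|U|] almost bounded by the Lipschitz constant of [f1].  As [M] is finite
   dimensional, convergence holds in the ideal norm too, whence
   [`|D|_A <= `|S|_A * Lip f1].
   Ultralimits of the difference quotients of the composition of [f2] with the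
   quotient map are Lipschitz maps [G2 -> F / L] that agree on the range of [D]
   with the linear map [D x |-> T x + L].  Averaging over that range and then over
   [G2], they become linear without changing there.  Hence the restriction of
   [T] to [M], taken modulo [L], factors through [D], with ideal norm at most
   [Lip f2 * `|S|_A * Lip f1], and maximality applies. *)
Require Import Defs.
From HB Require Import structures.
From mathcomp Require Import all_boot all_order all_algebra.
From mathcomp Require Import all_classical all_reals.
From mathcomp Require Import ereal topology normedtype sequences.
From mathcomp Require Import ring lra.
Import Order.TTheory GRing.Theory Num.Theory.
Import numFieldNormedType.Exports.
Local Open Scope classical_set_scope.
Local Open Scope ring_scope.
Set Implicit Arguments.
Unset Strict Implicit.

(** * Averages of Lipschitz maps over boxes *)

Section Averages.
Context {R : realType}.

Definition lip {V G : normedModType R} (K : R) (g : V -> G) :=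
  forall x y, `|g x - g y| <= K * `|x - y|.

Lemma lipschitz_lip (V G : normedModType R) (g : V -> G) :
  lipschitz g -> exists2 K, 0 <= K & lip K g.
Proof.
(* [lipschitz] gives the bound only for constants strictly above [K], and [K] may be negative; hence
   [K + 1] and the maximum with 0. *)
move=> [K [_ Kg]]; exists (Num.max 0 (K + 1)); first by rewrite le_max lexx.
have KK : K < Num.max 0 (K + 1) by rewrite lt_max ltrDl ltr01 orbT.
by move=> x y; have := Kg _ KK (x, y); apply.
Qed.

Lemma lip_lipschitz (V G : normedModType R) (K : R) (g : V -> G) :
  lip K g -> lipschitz g.
Proof.
move=> gK; exists K; split; first exact: num_real.
move=> M KM [x y] _ /=; rewrite (le_trans (gK x y))//.
by rewrite ler_wpM2r// ltW.
Qed.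

Context {V G : normedModType R}.

Definition diff (b : V) (g : V -> G) : V -> G := fun x => g (x + b) - g x.

Definition avg (k : nat) (b : V) (g : V -> G) : V -> G :=
  fun x => k.+1%:R^-1 *: \sum_(j < k.+1) g (x + b *+ j).

(** The mean over a box with sides along [s], taken one direction at a time, so that properties of
    [avg] pass to boxes by induction on [s]. *)
Definition avgs (k : nat) (s : seq V) (g : V -> G) : V -> G :=
  foldr (avg k) g s.

Lemma avg_const_on (W : set V) k b g (c : G) :
  (forall x y, W x -> W y -> W (x + y)) -> W 0 -> W b ->
  (forall x, W x -> g x = c) -> forall x, W x -> avg k b g x = c.
Proof.
move=> WD W0 Wb gc x Wx; rewrite /avg.
have WM j : W (b *+ j).
  by elim: j => [|j IH]; rewrite ?mulr0n// mulrS; exact: WD.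
rewrite (eq_bigr (fun=> c)); last by move=> j _; rewrite gc//; exact: WD.
by rewrite sumr_const card_ord -[c *+ _]scaler_nat scalerA mulVf ?pnatr_eq0// scale1r.
Qed.

Lemma avgs_const_on (W : set V) k s g (c : G) :
  (forall x y, W x -> W y -> W (x + y)) -> W 0 -> (forall b, b \in s -> W b) ->
  (forall x, W x -> g x = c) -> forall x, W x -> avgs k s g x = c.
Proof.
move=> WD W0; elim: s => [//|b s IH] Ws gc; rewrite /= -/(avgs k s g).
apply: avg_const_on => //; first by apply: Ws; rewrite mem_head.
by apply: IH => // a sa; apply: Ws; rewrite inE sa orbT.
Qed.

Lemma diff_avg k a b g : diff b (avg k a g) = avg k a (diff b g).
Proof.
apply/funext => x; rewrite /diff /avg -scalerBr -sumrB; congr (_ *: _).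
by apply: eq_bigr => j _; rewrite addrAC.
Qed.

Lemma diff_avgs k s b g : diff b (avgs k s g) = avgs k s (diff b g).
Proof.
by elim: s => [//|a s IH]; rewrite /= -!/(avgs _ _ _) diff_avg IH.
Qed.

Lemma avg_lip K k b g : lip K g -> lip K (avg k b g).
Proof.
move=> gK x y; rewrite /avg -scalerBr -sumrB normrZ ger0_norm ?invr_ge0//.
rewrite ler_pdivrMl// (le_trans (ler_norm_sum _ _ _))//.
apply: (@le_trans _ _ (\sum_(j < k.+1) K * `|x - y|)).
  by apply: ler_sum => j _; rewrite (le_trans (gK _ _))// opprD addrACA subrr addr0.
by rewrite sumr_const card_ord mulr_natl.
Qed.

Lemma avgs_lip K k s g : lip K g -> lip K (avgs k s g).
Proof. by move=> gK; elim: s => [//|b s IH]; exact: avg_lip. Qed.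

(* The sum of differences telescopes, so only the two ends of the segment
   contribute. *)
Lemma diff_avg_lip K k b g : lip K g ->
  lip (2 * K / k.+1%:R) (diff b (avg k b g)).
Proof.
move=> gK x y.
have E z : diff b (avg k b g) z = k.+1%:R^-1 *: (g (z + b *+ k.+1) - g z).
  rewrite /diff /avg -scalerBr; congr (_ *: _).
  rewrite -sumrB -(big_mkord xpredT (fun j => g (z + b + b *+ j) - g (z + b *+ j))).
  rewrite (eq_bigr (fun j => g (z + b *+ j.+1) - g (z + b *+ j))).
    by rewrite telescope_sumr// mulr0n addr0.
  by move=> j _; rewrite mulrS addrA.
rewrite !E -scalerBr normrZ ger0_norm ?invr_ge0// mulrC mulrAC ler_wpM2r ?invr_ge0//.
have -> : g (x + b *+ k.+1) - g x - (g (y + b *+ k.+1) - g y) =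
    (g (x + b *+ k.+1) - g (y + b *+ k.+1)) - (g x - g y).
  by rewrite !opprB addrACA [RHS]addrACA; congr (_ + _); rewrite addrC.
rewrite (le_trans (ler_normB _ _))// -mulrA mulr_natl mulr2n lerD//.
by rewrite (le_trans (gK _ _))// opprD addrACA subrr addr0.
Qed.

End Averages.

(** At the place of [b] in the list [diff_avg_lip] applies; the averages taken after it commute with
    [diff b] and keep the constant. *)
Lemma diff_avgs_lip (R : realType) (V G : normedModType R) (K : R) k s b
    (g : V -> G) : lip K g -> b \in s ->
  lip (2 * K / k.+1%:R) (diff b (avgs k s g)).
Proof.
move=> gK; elim: s => [//|a s IH]; rewrite inE => /orP[/eqP->|/IH{}IH].
  by apply: diff_avg_lip; exact: avgs_lip.
by rewrite /= diff_avg; exact: avg_lip.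
Qed.

(** Bundles a map known to be linear, so that the rewriting rules for linear maps apply to it. *)
Lemma linear_pack (R : realType) (V W : lmodType R) (f : V -> W) :
  linear f -> exists L : {linear V -> W}, f = L.
Proof.
move=> lf; pose L : {linear V -> W} :=
  HB.pack f (GRing.isLinear.Build _ _ _ _ _ lf).
by exists L.
Qed.

Lemma avgs_linear (R : realType) (V G H : normedModType R) k s
    (g : V -> G) (S : G -> H) (x : V) : linear S ->
  S (avgs k s g x) = avgs k s (S \o g) x.
Proof.
move=> /linear_pack[{}S ->].
elim: s x => [//|b s IH] x; rewrite /= /avg linearZ linear_sum.
by congr (_ *: _); apply: eq_bigr => j _; exact: IH.
Qed.

Lemma avgs_cvg (R : realType) (V G : normedModType R) k s (I : Type)
    (F : set_system I) {FF : Filter F} (g_ : I -> V -> G) (g : V -> G) :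
  (forall x, g_ i x @[i --> F] --> g x) ->
  forall x, avgs k s (g_ i) x @[i --> F] --> avgs k s g x.
Proof.
move=> gg; elim: s => [//|b s IH] x.
apply: cvgZl_tmp.
by apply: cvg_big => [|j _]; [exact: add_continuous|exact: IH].
Qed.

(** * Almost additive Lipschitz maps along one direction *)

Section Stepping.
Context {R : realType} {V G : normedModType R} (K eta : R) (Phi : V -> G) (a : V).
Hypotheses (eta0 : 0 <= eta) (PhiK : lip K Phi) (Phi0 : Phi 0 = 0).
Hypothesis (Phia : forall x, `|Phi (x + a) - Phi x - Phi a| <= eta * `|x|).

(** Telescoping over [j] single steps: each starts at a point of norm at most [|x| + j |a|], which
    controls its error. *)
Lemma step_nat x (j : nat) :
  `|Phi (x + a *+ j) - Phi x - Phi a *+ j| <=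
    j%:R * eta * (`|x| + j%:R * `|a|).
Proof.
elim: j => [|j IH]; first by rewrite !mulr0n addr0 subrr subr0 normr0 !mul0r.
have -> : Phi (x + a *+ j.+1) - Phi x - Phi a *+ j.+1 =
    (Phi (x + a *+ j + a) - Phi (x + a *+ j) - Phi a) +
    (Phi (x + a *+ j) - Phi x - Phi a *+ j).
  rewrite mulrSr addrA [Phi a *+ j.+1]mulrS opprD.
  rewrite [RHS]addrACA; congr (_ + _).
  by rewrite addrA subrK.
rewrite (le_trans (ler_normD _ _))//.
rewrite (le_trans (lerD (Phia _) IH))//.
have h1 : `|x + a *+ j| <= `|x| + j%:R * `|a|.
  by rewrite (le_trans (ler_normD _ _))// normrMn mulr_natl.
have h2 : eta * `|x + a *+ j| <= eta * (`|x| + j%:R * `|a|) by rewrite ler_wpM2l.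
rewrite (le_trans (lerD h2 (lexx _)))//.
have j0 : 0 <= j%:R :> R by [].
rewrite -[j.+1%:R]natr1.
suff : 0 <= (j%:R + 1) * eta * `|a| by set u := j%:R; lra.
by rewrite !mulr_ge0// addr_ge0.
Qed.

(** Write [c = j + r] with [j] an integer and [0 <= r <= 1]. The part [j] is [step_nat]; the part
    [r] costs [K |a|] once in the argument of [Phi] and once in [r *: Phi a]. *)
Let step_pos x (c N : R) : 0 <= c <= N ->
  `|Phi (x + c *: a) - Phi x - c *: Phi a| <=
    N * eta * (`|x| + N * `|a|) + 2 * K * `|a|.
Proof.
move=> /andP[c0 cN]; have /andP[jc cj] := truncn_itv c0.
set j := Num.truncn c in jc cj.
pose r := c - j%:R.
have r0 : 0 <= r by rewrite subr_ge0.
have r1 : r <= 1 by rewrite lerBlDr addrC natr1 ltW.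
have Ka : 0 <= K * `|a|.
  by have := PhiK a 0; rewrite subr0; apply: le_trans.
have cE (W : normedModType R) (w : W) : c *: w = w *+ j + r *: w.
  by rewrite -scaler_nat -scalerDl /r addrC subrK.
have -> : Phi (x + c *: a) - Phi x - c *: Phi a =
    (Phi (x + c *: a) - Phi (x + a *+ j)) +
    (Phi (x + a *+ j) - Phi x - Phi a *+ j) - r *: Phi a.
  rewrite [in c *: Phi a]cE opprD !addrA; congr (_ - _); congr (_ - _).
  by rewrite subrK.
rewrite (le_trans (ler_normB _ _))//.
rewrite (le_trans (lerD (ler_normD _ _) (lexx _)))//.
have h1 : `|Phi (x + c *: a) - Phi (x + a *+ j)| <= K * `|a|.
  rewrite (le_trans (PhiK _ _))// cE addrA [x + _ + _]addrC addrK normrZ ger0_norm//.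
  by rewrite mulrCA ler_piMl.
have h2 : `|r *: Phi a| <= K * `|a|.
  rewrite normrZ ger0_norm// (le_trans (ler_piMl _ r1))//.
  by have := PhiK a 0; rewrite Phi0 !subr0.
have h3 := step_nat x j.
have h4 : j%:R * eta * (`|x| + j%:R * `|a|) <= N * eta * (`|x| + N * `|a|).
  have jN := le_trans jc cN.
  apply: ler_pM; first exact: mulr_ge0.
  - by rewrite addr_ge0// mulr_ge0.
  - by rewrite ler_wpM2r.
  - by rewrite lerD2l ler_wpM2r.
lra.
Qed.

Lemma step_real x (c N : R) : `|c| <= N ->
  `|Phi (x + c *: a) - Phi x - c *: Phi a| <=
    N * eta * (`|x| + 2 * N * `|a|) + 2 * K * `|a|.
Proof.
move=> cN; have N0 : 0 <= N by rewrite (le_trans _ cN).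
have Na : 0 <= N * `|a| by rewrite mulr_ge0.
have Ne : 0 <= N * eta by rewrite mulr_ge0.
have [c0|c0] := leP 0 c.
  have cN' : 0 <= c <= N by rewrite c0 (le_trans (ler_norm _)).
  rewrite (le_trans (step_pos x cN'))// lerD2r ler_wpM2l// lerD2l; lra.
(* For negative [c], step forward by [- c] from the base point [x + c *: a]. Its norm is at most
   [|x| + N |a|], which accounts for the factor 2 before [N]. *)
have cN' : 0 <= - c <= N by rewrite oppr_ge0 (ltW c0)/= (le_trans _ cN)// -normrN ler_norm.
have := step_pos (x + c *: a) cN'.
rewrite scaleNr addrK scaleNr opprK => h.
have -> : Phi (x + c *: a) - Phi x - c *: Phi a =
    - (Phi x - Phi (x + c *: a) + c *: Phi a) by rewrite opprD opprB.
rewrite normrN (le_trans h)//.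
rewrite lerD2r ler_wpM2l//.
have : `|x + c *: a| <= `|x| + N * `|a|.
  by rewrite (le_trans (ler_normD _ _))// lerD2l normrZ ler_wpM2r.
lra.
Qed.

End Stepping.

(** For an additive map [step_real] holds with [eta = 0], and its error [2 K |x|] does not depend on
    the multiple. Taking the multiple [n c] and dividing by [n] makes it arbitrarily small. *)
Lemma additive_lip_linear (R : realType) (V G : normedModType R) (K : R)
    (h : V -> G) :
  lip K h -> (forall x y, h (x + y) = h x + h y) -> linear h.
Proof.
move=> hK hD.
have h0 : h 0 = 0 by apply: (addIr (h 0)); rewrite -hD !add0r.
have hM x n : h (x *+ n) = h x *+ n.
  by elim: n => [|n IH]; rewrite ?mulr0n// !mulrS hD IH.
suff hZ c x : h (c *: x) = c *: h x by move=> c x y; rewrite hD hZ.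
apply/eqP; rewrite -subr_eq0 -normr_le0; apply/ler_addgt0Pr => e e0; rewrite add0r.
have B n : n%:R * `|h (c *: x) - c *: h x| <= 2 * K * `|x|.
  have ha y : `|h (y + x) - h y - h x| <= 0 * `|y|.
    by rewrite hD addrAC addrK subrr normr0 mul0r.
  have := step_real (lexx 0) hK h0 ha 0 (lexx `|n%:R * c|).
  rewrite mulr0 mul0r !add0r h0 subr0 -!scalerA !scaler_nat hM -mulrnBl normrMn.
  by rewrite -[_ *+ n]mulr_natl.
have [M Mn] : exists M, 2 * K * `|x| / e <= M.+1%:R.
  by exists (Num.truncn (2 * K * `|x| / e)); exact/ltW/truncnS_gt.
rewrite -(ler_pM2l (ltr0Sn R M)) (le_trans (B _))//.
by rewrite -ler_pdivrMr.
Qed.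

(** * Coordinates, ultralimits and means in finite dimension *)

Lemma fd_coords (R : realType) (V : normedModType R) : finite_dim V ->
  exists (n : nat) (b : 'I_n -> V) (beta : 'I_n -> V -> R) (C : R),
    [/\ 0 <= C, forall i, linear (beta i : V -> R^o), forall i x, `|beta i x| <= C * `|x| &
        forall x, x = \sum_(i < n) beta i x *: b i].
Proof.
move=> fdV.
pose P n := `[< exists b : 'I_n -> V, forall v, exists c : 'I_n -> R, v = \sum_(i < n) c i *: b i >].
have exP : exists n, P n by have [n [b h]] := fdV; exists n; apply/asboolP; exists b.
case: (ex_minnP exP) => n /asboolP[b bs] nmin.
(* The spanning family has least size, so [b i] lies outside the closed span [L] of the others. A
   ball around [b i] missing [L] has a radius that bounds the [i]-th coordinate. *)
have indep (i : 'I_n) : exists d : R, 0 < d /\ forall c : 'I_n -> R, d * `|c i| <= `|\sum_(j < n) c j *: b j|.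
  pose L := [set v | exists c : 'I_n -> R, v = \sum_(j < n) c j *: (if j == i then 0 else b j)].
  have Lcl : closed L by exact: finite_span_closed.
  have Lb : ~ L (b i).
    move=> [c0 E].
    case: n b bs nmin i L Lcl c0 E => [|n] b bs nmin i L Lcl c0 E; first by case: i {L Lcl E}.
    suff /nmin : P n by rewrite ltnn.
    apply/asboolP; exists (fun j => b (lift i j)) => v; have [c ->] := bs v.
    exists (fun j => c (lift i j) + c i * c0 (lift i j)).
    rewrite (bigD1_ord i)//= {1}E (bigD1_ord i)//= eqxx scaler0 add0r scaler_sumr -big_split/=.
    apply: eq_bigr => j _; rewrite eq_sym (negbTE (neq_lift _ _)) scalerA scalerDl addrC//.
  have : nbhs (b i) (~` L) by apply: open_nbhs_nbhs; split => //; exact: closed_openC.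
  move=> /nbhs_ballP[d /= d0 dL]; exists d; split => // c.
  have [->|ci0] := eqVneq (c i) 0; first by rewrite normr0 mulr0.
  rewrite -ler_pdivlMr ?normr_gt0// leNgt; apply/negP => lt.
  have nL : (~` L) (b i - (c i)^-1 *: \sum_(j < n) c j *: b j).
    apply: dL; rewrite -ball_normE /= opprB addrC subrK normrZ normfV mulrC//.
  apply: nL; exists (fun j => - ((c i)^-1 * c j)).
  rewrite (bigD1 i)//= scalerDr scalerA mulVf// scale1r opprD addrA subrr sub0r.
  rewrite [RHS](bigD1 i)//= eqxx scaler0 add0r scaler_sumr -sumrN.
  by apply: eq_bigr => j /negbTE->; rewrite scaleNr scalerA.
have [d d0 dP] : exists2 d : R, 0 < d & forall i c, d * `|c i| <= `|\sum_(j < n) c j *: b j|.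
  have [d /all_and2[d0 dP]] := choice indep.
  (* The initial value 1 keeps the minimum positive also for an empty family. *)
  exists (\big[Num.min/1]_i d i); first by apply: lt_bigmin.
  move=> i c; rewrite (le_trans _ (dP i c))// ler_wpM2r// bigmin_le_cond//.
have [c cP] := choice bs.
have uniq c1 c2 : \sum_(j < n) c1 j *: b j = \sum_(j < n) c2 j *: b j -> c1 =1 c2.
  move=> E i; have := dP i (fun j => c1 j - c2 j).
  rewrite (eq_bigr (fun j => c1 j *: b j - c2 j *: b j)); last by move=> j _; rewrite scalerBl.
  rewrite sumrB E subrr normr0 pmulr_rle0// normr_le0 subr_eq0 => /eqP//.
exists n, b, (fun i x => c x i), d^-1; split => //.
- by rewrite invr_ge0 ltW.
- move=> i a x y; rewrite -[RHS]/((fun j => a * c x j + c y j) i).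
  apply: uniq; rewrite -cP [in LHS](cP x) [in LHS](cP y) scaler_sumr -big_split/=.
  by apply: eq_bigr => j _; rewrite scalerDl scalerA.
- by move=> i x; rewrite -ler_pdivrMl// ?invr_gt0// invrK mulrC {2}(cP x) mulrC dP.
Qed.

Lemma fmap_ultra (I J : Type) (f : I -> J) (U : set_system I) :
  UltraFilter U -> UltraFilter (f @ U).
Proof.
move=> UU; split; first exact: fmap_proper_filter.
move=> G PG fUG; apply/seteqP; split => // A GA.
have [//|UA] := in_ultra_setVsetC (f @^-1` A) UU.
have [x [Ax]] := filter_ex (filterI GA (fUG (~` A) UA)).
by move=> /(_ Ax).
Qed.

Lemma cvg_normr_le (R : realType) (V : normedModType R) (I : Type)
    (F : set_system I) {FF : ProperFilter F} (u : I -> V) (l : V) (c : R) :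
  u i @[i --> F] --> l -> (\forall i \near F, `|u i| <= c) -> `|l| <= c.
Proof.
move=> ul uc; apply/ler_addgt0Pr => e e0.
have /cvgrPdist_lt/(_ e e0) ule := ul.
have [i [/= h1 h2]] := filter_ex (filterI ule uc).
by rewrite -(subrK (u i) l) (le_trans (ler_normD _ _))// addrC lerD// ltW.
Qed.

(** Each coordinate stays in a compact segment, where the image ultrafilter converges. *)
Lemma fd_ultra_cvg (R : realType) (Y : normedModType R) (I : Type)
    (U : set_system I) {UU : UltraFilter U} (phi : I -> Y) (c : R) :
  finite_dim Y -> (forall i, `|phi i| <= c) -> exists l : Y, phi i @[i --> U] --> l.
Proof.
move=> /fd_coords[n [b [beta [C [C0 _ betaC betaE]]]]] phic.
have ex j : exists l : R, beta j (phi i) @[i --> U] --> l.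
  have Ul : UltraFilter ((fun i => beta j (phi i)) @ U) by exact: fmap_ultra.
  have UK : ((fun i => beta j (phi i)) @ U) `[- (C * c), C * c]%classic.
    rewrite /fmap/=; apply: (@filterS _ U _ setT) => [i _|]; last exact: filterT.
    by rewrite /= in_itv/= -ler_norml (le_trans (betaC _ _))// ler_wpM2l.
  have := @segment_compact R (- (C * c)) (C * c); rewrite compact_ultra.
  by move=> /(_ _ Ul UK)[l [_ h]]; exists l.
have [l hl] := choice ex; exists (\sum_(j < n) l j *: b j).
rewrite (_ : phi = fun i => \sum_(j < n) beta j (phi i) *: b j); last first.
  by apply/funext => i; exact: betaE.
by apply: cvg_big => [|j _]; [exact: add_continuous|exact: cvgZr_tmp].
Qed.

(* Mean of the differences of [h] over the semigroup [W], as an ultralimit of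
   averages over large boxes in [W]. *)
Lemma lip_invariant_mean (R : realType) (V Y : normedModType R) (K : R)
    (W : set V) (h : V -> Y) :
  finite_dim Y -> W 0 -> (forall x y, W x -> W y -> W (x + y)) -> lip K h ->
  exists h' : V -> Y, [/\ lip K h',
    forall x w, W w -> h' (x + w) = h' x + h' w &
    forall w c, (forall x, W x -> h (x + w) - h x = c) -> h' w = c].
Proof.
move=> fdY W0 WD hK.
(* Indices are lists of steps in [W] with a box size, directed by inclusion and growth;
   concatenation and maximum give upper bounds. Every [w] in [W] is eventually one of the steps. *)
pose D := [set i : seq V * nat | forall w, w \in i.1 -> W w].
pose B (i : seq V * nat) := [set i' : seq V * nat |
  [/\ D i', {subset i.1 <= i'.1} & (i.2 <= i'.2)%N]].
have FF : Filter (filter_from D B).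
  apply: filter_from_filter; first by exists ([::], 0%N).
  move=> [s k] [s' k'] Ds Ds'; exists (s ++ s', maxn k k').
    by move=> w; rewrite /= mem_cat => /orP[/Ds|/Ds'].
  move=> [t m] [Dt /= st]; rewrite geq_max => /andP[km k'm].
  by split; split => //= w sw; apply: st; rewrite mem_cat sw ?orbT.
have PF : ProperFilter (filter_from D B).
  by apply: filter_from_proper => i Di; exists i; split.
have [U [UU FU]] := ultraFilterLemma PF.
have UB i : D i -> U (B i) by move=> Di; apply: FU; exists i.
(* Subtracting the value at 0 gives the bound [K |x|], uniform in [i], needed for the ultralimit. *)
pose phi (i : seq V * nat) x := avgs i.2 i.1 h x - avgs i.2 i.1 h 0.
have phiK i : lip K (phi i).
  by move=> x y; rewrite /phi opprB addrA subrK; exact: avgs_lip.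
have ex x : exists l : Y, phi i x @[i --> U] --> l.
  apply: (@fd_ultra_cvg _ _ _ _ _ _ (K * `|x|)) => // i.
  by have := phiK i x 0; rewrite /phi subrr !subr0.
have [h' h'P] := choice ex.
exists h'; split.
- move=> x y; apply: (cvg_normr_le (cvgB (h'P x) (h'P y))).
  by apply: nearW => i; exact: phiK.
- move=> x w Ww; apply/eqP; rewrite -subr_eq0 -normr_le0.
  apply/ler_addgt0Pr => e e0; rewrite add0r.
  have h1 : (phi^~ (x + w) \- (phi^~ x \+ phi^~ w)) i @[i --> U] -->
      h' (x + w) - (h' x + h' w) by apply: cvgB => //; exact: cvgD.
  apply: (cvg_normr_le h1).
  (* From size [m] on, the defect of additivity [2 K |x| / (k + 1)] is at most [e]. *)
  have [m hm] : exists m : nat, 2 * K * `|x| / e <= m%:R.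
    by exists (Num.truncn (2 * K * `|x| / e)).+1; exact/ltW/truncnS_gt.
  have Dw : D ([:: w], m) by move=> v; rewrite /= inE => /eqP ->.
  apply: filterS (UB _ Dw) => -[s k] [/= Ds ws mk].
  have wins : w \in s by apply: ws; rewrite mem_head.
  have := diff_avgs_lip k hK wins x 0.
  rewrite subr0 /diff /phi /= add0r.
  have -> a b c d : a - d - (b - d + (c - d)) = a - b - (c - d) :> Y.
    by rewrite opprD addrA; congr (_ - _); rewrite opprB addrA subrK.
  move=> /le_trans; apply.
  rewrite mulrAC ler_pdivrMr// [leRHS]mulrC -ler_pdivrMr// (le_trans hm)//.
  by rewrite ler_nat (leq_trans mk).
- move=> w c hc; apply/eqP; rewrite eq_sym -subr_eq0 -normr_le0.
  have h1 : (fun i => c - phi i w) @ U --> c - h' w.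
    by apply: cvgB => //; exact: cvg_cst.
  apply: (cvg_normr_le h1); have D0 : D ([::], 0%N) by [].
  apply: filterS (UB _ D0) => -[s k] [/= Ds _ _]; rewrite /phi /=.
  (* A box based at 0 with steps in [W] stays in [W], where the increment of [h] along [w] is
     [c]. *)
  have := avgs_const_on (g := diff w h) k WD W0 Ds hc W0.
  by rewrite -diff_avgs /diff add0r => ->; rewrite subrr normr0.
Qed.

(* The linear map is prescribed by the increments along the short steps
   [b i / m.+1], since almost additivity only controls integer multiples of a
   step; a real multiple costs one more step. *)
Lemma linearize_avgs (R : realType) (V : normedModType R) n (b : 'I_n -> V)
    (beta : 'I_n -> V -> R) (C K e : R) : 0 <= C -> 0 <= K -> 0 < e ->
  (forall i x, `|beta i x| <= C * `|x|) ->
  (forall x, x = \sum_(i < n) beta i x *: b i) ->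
  exists (k m : nat) (s : seq V), forall (G : normedModType R) (g : V -> G),
    lip K g -> forall x, `|x| <= 1 ->
    `|\sum_(i < n) beta i x *:
       (diff (m.+1%:R^-1 *: b i) (avgs k s g) 0 *+ m.+1)| <= K * `|x| + e.
Proof.
move=> C0 K0 e0 betaC betaE.
pose B := \sum_(i < n) `|b i|.
have B0 : 0 <= B by exact: sumr_ge0.
have bB i : `|b i| <= B by rewrite /B (bigD1 i)//= lerDl sumr_ge0.
(* Each of the [n] coordinates will cost [2 * e1], which adds up to at most [e]. *)
pose e1 := e / (2 * n.+1%:R).
have e10 : 0 < e1 by rewrite divr_gt0.
have [m hm] : exists m : nat, 2 * K * B / e1 <= m.+1%:R.
  exists (Num.truncn (2 * K * B / e1)).
  exact/ltW/truncnS_gt.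
pose a i := m.+1%:R^-1 *: b i.
(* [m] makes the steps so short that the term [2 K |a i|] of [step_real] is at most [e1]. [N] bounds
   the multiples of [a i] needed when [|x| <= 1], and [Q / (k + 1)] bounds the other term. As [Q]
   depends on [m], the box size [k] is chosen last. *)
pose N := C * m.+1%:R.
have N0 : 0 <= N by rewrite mulr_ge0.
pose Q := N * (C * B + 2 * N * B) * (2 * K).
have Q0 : 0 <= Q by rewrite !mulr_ge0// addr_ge0// !mulr_ge0.
have [k hk] : exists k : nat, Q / e1 <= k.+1%:R.
  exists (Num.truncn (Q / e1)).
  exact/ltW/truncnS_gt.
exists k, m, [seq a i | i <- enum 'I_n] => G g gK x x1.
set h := avgs k _ g.
pose Phi y := h y - h 0.
have hK : lip K h by exact: avgs_lip.
have PhiK : lip K Phi.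
  by move=> y z; rewrite /Phi opprB addrA subrK.
have Phi0 : Phi 0 = 0 by rewrite /Phi subrr.
pose eta := 2 * K / k.+1%:R.
have eta0 : 0 <= eta by rewrite divr_ge0// mulr_ge0.
have Phia i y : `|Phi (y + a i) - Phi y - Phi (a i)| <= eta * `|y|.
  have ai : a i \in [seq a i | i <- enum 'I_n] by apply: map_f; rewrite mem_enum.
  have := diff_avgs_lip k gK ai y 0; rewrite -/h -/eta subr0 /diff add0r.
  have -> : Phi (y + a i) - Phi y = h (y + a i) - h y.
    by rewrite /Phi opprB addrA subrK.
  by [].
have -> : \sum_(i < n) beta i x *: (diff (m.+1%:R^-1 *: b i) h 0 *+ m.+1) =
    \sum_(i < n) (beta i x *+ m.+1) *: Phi (a i).
  by apply: eq_bigr => i _; rewrite /diff add0r /Phi -/(a i) -scalerMnr scalerMnl.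
have key i y : `|y| <= C * B ->
    `|Phi (y + (beta i x *+ m.+1) *: a i) - Phi y - (beta i x *+ m.+1) *: Phi (a i)|
      <= 2 * e1.
  move=> yB; have cN : `|beta i x *+ m.+1| <= N.
    rewrite normrMn -mulr_natr ler_wpM2r// (le_trans (betaC _ _))//.
    by rewrite ler_piMr.
  have := step_real eta0 PhiK Phi0 (Phia i) y cN; move=> /le_trans; apply.
  have h0 : 0 <= `|a i| <= B / m.+1%:R.
    rewrite normr_ge0/= /a normrZ ger0_norm ?invr_ge0// mulrC.
    by rewrite ler_wpM2r// invr_ge0.
  have aB : `|a i| <= B.
    by case/andP: h0 => _ /le_trans; apply; rewrite ler_pdivrMr// ler_peMr// ler1n.
  have h1 : 2 * K * `|a i| <= e1.
    apply: (@le_trans _ _ (2 * K * (B / m.+1%:R))).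
      by rewrite ler_wpM2l ?mulr_ge0//; case/andP: h0.
    by rewrite mulrA ler_pdivrMr// [leRHS]mulrC -ler_pdivrMr.
  have h2 : N * eta * (`|y| + 2 * N * `|a i|) <= e1.
    apply: (@le_trans _ _ (N * eta * (C * B + 2 * N * B))).
      by rewrite ler_wpM2l ?mulr_ge0// lerD// ler_wpM2l// mulr_ge0.
    rewrite (_ : _ * _ = Q / k.+1%:R); last by rewrite /Q /eta; ring.
    by rewrite ler_pdivrMr// [leRHS]mulrC -ler_pdivrMr.
  by rewrite (le_trans (lerD h2 h1))// [leRHS]mulr_natl mulr2n.
(* The vector is built up one coordinate at a time; without repetitions in [r] the partial sums stay
   below [C * B], as [key] requires. *)
have partial (r : seq 'I_n) : uniq r ->
    `|Phi (\sum_(i <- r) beta i x *: b i) -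
      \sum_(i <- r) (beta i x *+ m.+1) *: Phi (a i)| <= (size r)%:R * (2 * e1).
  elim: r => [|i r IH] /=; first by rewrite !big_nil Phi0 subrr normr0 mul0r.
  move=> /andP[ir ur]; rewrite !big_cons.
  set y := \sum_(j <- r) beta j x *: b j.
  have yB : `|y| <= C * B.
    rewrite /y (le_trans (ler_norm_sum _ _ _))// /B mulr_sumr.
    apply: (@le_trans _ _ (\sum_(j <- r) C * `|b j|)).
      apply: ler_sum => j _; rewrite normrZ ler_wpM2r// (le_trans (betaC _ _))//.
      by rewrite ler_piMr.
    rewrite big_uniq//= [leRHS](bigID (mem r))/= lerDl sumr_ge0// => j _.
    by rewrite mulr_ge0.
  have := key i y yB; have := IH ur.
  have -> : (beta i x *+ m.+1) *: a i = beta i x *: b i.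
    by rewrite /a scalerA -[beta i x *+ _]mulr_natr mulfK ?pnatr_eq0.
  rewrite [y + _]addrC -/y.
  set u := Phi _; set v := Phi _; set p := \sum_(j <- r) _; set q := _ *: Phi _.
  move=> h1 h2.
  have id4 (c d w z : G) : d - (w + z) = (d - c - w) + (c - z).
    by rewrite opprD !addrA; congr (_ - _); rewrite [RHS]addrAC subrK.
  rewrite (id4 u).
  rewrite (le_trans (ler_normD _ _))// (le_trans (lerD h2 h1))//.
  by rewrite -[(size r).+1%:R]natr1 [leRHS]mulrDl mul1r [leLHS]addrC.
have := partial _ (index_enum_uniq 'I_n); rewrite -betaE.
set s := \sum_(i <- _) _; rewrite -/s => hs.
have -> : s = Phi x - (Phi x - s) by rewrite opprB addrC subrK.
rewrite (le_trans (ler_normB _ _))// lerD//.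
  by have := PhiK x 0; rewrite Phi0 !subr0.
rewrite (le_trans hs)// [index_enum _]unlock -enumT size_enum_ord /e1.
rewrite (_ : _ * _ = e * (n%:R / n.+1%:R)); last by field; rewrite ?natr1 ?nat1r pnatr_eq0.
by rewrite ler_piMr ?(ltW e0)// ler_pdivrMr// mul1r ler_nat.
Qed.

(** * Operator ideals *)

Lemma op_norm_le (R : realType) (E F : normedModType R) (Q : E -> F) (C : R) :
  0 <= C -> (forall x, `|Q x| <= C * `|x|) -> op_norm Q <= C.
Proof.
move=> C0 QC; apply: ge_sup; first by exists `|Q 0|, 0; rewrite //= normr0.
by move=> _ [x /= x1 <-]; rewrite (le_trans (QC _))// ler_piMr.
Qed.

Lemma op_norm_ge0 (R : realType) (E F : normedModType R) (Q : E -> F) :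
  bounded_linear Q -> 0 <= op_norm Q.
Proof.
move=> [_ [C QC]]; apply: le_trans (normr_ge0 (Q 0)) _; apply: ub_le_sup.
  exists `|C| => _ [x /= x1 <-]; rewrite (le_trans (QC _))//.
  rewrite (le_trans (ler_wpM2r (normr_ge0 _) (ler_norm C)))//.
  by rewrite ler_piMr.
by exists 0; rewrite //= normr0.
Qed.

Section Ideal.
Context {R : realType} (A : banachIdeal R).

Lemma ideal_comp_bound (E0 E F F0 : completeNormedModType R)
    (P : F -> F0) (T : E -> F) (Q : E0 -> E) (a c : R) :
  0 <= a -> 0 <= c -> linear P -> linear Q ->
  (forall x, `|P x| <= a * `|x|) -> (forall x, `|Q x| <= c * `|x|) ->
  ideal_mem A T ->
  ideal_mem A (P \o T \o Q) /\
  ideal_norm A (P \o T \o Q) <= a * ideal_norm A T * c.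
Proof.
move=> a0 c0 lP lQ Pa Qc AT.
have bP : bounded_linear P by split => //; exists a.
have bQ : bounded_linear Q by split => //; exists c.
split; first exact: ideal_comp.
rewrite (le_trans (ideal_norm_comp bP AT bQ))//.
apply: ler_pM; [|exact: op_norm_ge0| |exact: op_norm_le].
- by rewrite mulr_ge0 ?op_norm_ge0 ?ideal_norm_ge0.
- by rewrite ler_wpM2r ?ideal_norm_ge0 ?op_norm_le.
Qed.

(** The map factors through the identity of the scalars, which has ideal norm 1. *)
Lemma ideal_rank_one (E F : completeNormedModType R) (beta : E -> R) (y : F)
    (C : R) :
  0 <= C -> linear (beta : E -> R^o) -> (forall x, `|beta x| <= C * `|x|) ->
  ideal_mem A (fun x => beta x *: y) /\
  ideal_norm A (fun x => beta x *: y) <= C * `|y|.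
Proof.
move=> C0 lb bC.
have lP : linear (fun l : R^o => l *: y) by move=> l u v; rewrite scalerDl scalerA.
have Py (l : R) : `|l *: y| <= `|y| * `|l| by rewrite normrZ mulrC.
have := @ideal_comp_bound E R R F (fun l => l *: y) idfun beta `|y| C
  (normr_ge0 _) C0 lP lb Py bC (ideal_id A).
by rewrite ideal_norm_id mulr1 mulrC.
Qed.

Lemma ideal_finite_rank (E F : completeNormedModType R) n
    (beta : 'I_n -> E -> R) (y : 'I_n -> F) (C : R) :
  0 <= C -> (forall i, linear (beta i : E -> R^o)) ->
  (forall i x, `|beta i x| <= C * `|x|) ->
  ideal_mem A (fun x => \sum_(i < n) beta i x *: y i) /\
  ideal_norm A (fun x => \sum_(i < n) beta i x *: y i) <= \sum_(i < n) C * `|y i|.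
Proof.
move=> C0 lb bC; elim: (index_enum _) => [|i r [IHm IHn]].
  have l0 : linear ((fun=> 0) : E -> R^o) by move=> a u v; rewrite scaler0 addr0.
  have b0 x : `|((fun=> 0) : E -> R) x| <= 0 * `|x| by rewrite normr0 mul0r.
  have [] := @ideal_rank_one E F (fun=> 0) 0 0 (lexx 0) l0 b0.
  rewrite big_nil mul0r (_ : (fun x => \sum_(i <- [::]) beta i x *: y i) = (fun=> 0 *: 0))//.
  by apply/funext => x; rewrite big_nil scaler0.
have [m1 n1] := ideal_rank_one (y i) C0 (lb i) (bC i).
rewrite (_ : (fun x => _) = (fun x => beta i x *: y i) \+
  (fun x => \sum_(j <- r) beta j x *: y j)); last first.
  by apply/funext => x; rewrite big_cons.
split; first exact: ideal_add.
by rewrite big_cons (le_trans (ideal_norm_add m1 IHm))// lerD.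
Qed.

(* [D] is a limit of operators [S \o U] with [U] linear and [`|U|] close to [K]:
   take for [U] the linearised averages of [g_ i], and correct by an operator on
   the finite-dimensional space [M] whose norm in the ideal is small. *)
Lemma ideal_limit (M G1 G2 : completeNormedModType R) (S : G1 -> G2)
    (I : Type) (F : set_system I) {FF : ProperFilter F} (g_ : I -> M -> G1)
    (D : M -> G2) (K : R) :
  finite_dim M -> 0 <= K -> ideal_mem A S -> (forall i, lip K (g_ i)) ->
  linear D -> (forall x, S (g_ i x) @[i --> F] --> D x) ->
  ideal_mem A D /\ ideal_norm A D <= ideal_norm A S * K.
Proof.
move=> fdM K0 AS gK lD SgD.
have [n [b [beta [C [C0 lb bC bE]]]]] := fd_coords fdM.
have S0 := ideal_norm_ge0 AS.
have [lS _] := ideal_bounded AS.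
suff key (e : R) : 0 < e ->
    ideal_mem A D /\ ideal_norm A D <= ideal_norm A S * (K + e) + e.
  split; first exact: (key 1 ltr01).1.
  apply/ler_addgt0Pr => e e0.
  (* With this value in place of [e], the excess in [key] is [(|S|_A + 1)] times it, that is [e]. *)
  have e1 : 0 < e / (ideal_norm A S + 1) by rewrite divr_gt0// ltr_wpDl.
  have [_ /le_trans] := key _ e1; apply; rewrite mulrDr -addrA lerD2l.
  by rewrite -[X in _ + X]mul1r -mulrDl mulrC divfK// gt_eqF// ltr_wpDl.
move=> e0.
have [k [m [s U1]]] := linearize_avgs C0 K0 e0 bC bE.
pose a i := m.+1%:R^-1 *: b i.
pose U t x := \sum_(i < n) beta i x *: (diff (a i) (avgs k s (g_ t)) 0 *+ m.+1).
pose w t i := diff (a i) (avgs k s (S \o g_ t)) 0 *+ m.+1.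
have lU t : linear (U t).
  move=> c x y; rewrite /U scaler_sumr -big_split/=; apply: eq_bigr => i _.
  by rewrite lb scalerDl scalerA.
have Ue t x : `|U t x| <= (K + e) * `|x|.
  have /linear_pack[L LE] := lU t.
  have [->|x0] := eqVneq x 0; first by rewrite LE linear0 !normr0 mulr0.
  have nx : 0 < `|x| by rewrite normr_gt0.
  have n1 : `|(`|x|^-1 *: x)| = 1.
    by rewrite normrZ ger0_norm ?invr_ge0// mulVf// gt_eqF.
  have := U1 G1 (g_ t) (gK t) (`|x|^-1 *: x); rewrite n1 -/(U t _) mulr1 => /(_ (lexx _)).
  by rewrite LE linearZ normrZ ger0_norm ?invr_ge0// ler_pdivrMl// mulrC.
have SU t x : S (U t x) = \sum_(i < n) beta i x *: w t i.
  have /linear_pack[L LE] := lS.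
  rewrite LE linear_sum; apply: eq_bigr => i _; rewrite linearZ linearMn /w.
  by congr (_ *: (_ *+ _)); rewrite /diff linearB -LE !(avgs_linear _ _ _ _ lS).
have /linear_pack[L LE] := lD.
(* Averaging does not change the increments of the linear map [D], and [m + 1] increments along
   [a i] make up [D (b i)]. *)
have wD i : w t i @[t --> F] --> D (b i).
  have -> : D (b i) = diff (a i) (avgs k s D) 0 *+ m.+1.
    rewrite diff_avgs (@avgs_const_on _ _ _ setT k s _ (D (a i)))//; last first.
      by move=> x _; rewrite /diff LE linearD addrAC subrr add0r.
    rewrite LE -linearMn; congr (L _).
    by rewrite -[RHS]scaler_nat scalerA mulfV ?scale1r ?pnatr_eq0.
  have cv x : avgs k s (S \o g_ t) x @[t --> F] --> avgs k s D x.
    exact: avgs_cvg.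
  rewrite /w /diff -scaler_nat.
  under eq_fun do rewrite -scaler_nat.
  by apply: cvgZl_tmp; exact: cvgB.
(* This sum bounds the ideal norm of the finite-rank correction [D - S \o U t]. *)
have err : \sum_(i < n) C * `|D (b i) - w t i| @[t --> F] --> (0 : R).
  have z0 : \sum_(i < n) C * `|D (b i) - D (b i)| = 0.
    by rewrite big1// => i _; rewrite subrr normr0 mulr0.
  rewrite -[X in _ --> X]z0; apply: cvg_big => [|i _]; first exact: add_continuous.
  by apply: cvgMr; apply: cvg_norm; apply: cvgB => //; exact: cvg_cst.
have /cvgrPdist_lt/(_ e e0)/filter_ex[t /=] := err.
rewrite sub0r normrN ger0_norm; last by rewrite sumr_ge0// => i _; rewrite mulr_ge0.
move=> terr.
have lid : linear (@idfun G2) by [].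
have idb x : `|@idfun G2 x| <= 1 * `|x| by rewrite mul1r.
have Ke : 0 <= K + e by rewrite addr_ge0// ltW.
have [m1 n1] := ideal_comp_bound ler01 Ke lid (lU t) idb (Ue t) AS.
have [m2 n2] := ideal_finite_rank (fun i => D (b i) - w t i) C0 lb bC.
have -> : D = (idfun \o S \o U t) \+ (fun x => \sum_(i < n) beta i x *: (D (b i) - w t i)).
  apply/funext => x /=; rewrite SU -big_split/= {1}(bE x) LE linear_sum.
  by apply: eq_bigr => i _; rewrite linearZ -scalerDr addrC subrK.
split; first exact: ideal_add.
rewrite (le_trans (ideal_norm_add m1 m2))// lerD//; first by rewrite mul1r in n1.
by rewrite (le_trans n2)// ltW.
Qed.

End Ideal.

(** * Linear extension and factorization through the derivative *)

Lemma linear_lip_extension (R : realType) (M G Y : normedModType R)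
    (D : M -> G) (tau : M -> Y) (K : R) (I : Type) (F : set_system I)
    {FF : ProperFilter F} (h_ : I -> G -> Y) :
  finite_dim Y -> linear D -> linear tau ->
  (forall i, lip K (h_ i)) -> (forall i, h_ i 0 = 0) ->
  (forall x, h_ i (D x) @[i --> F] --> tau x) ->
  exists P : G -> Y, [/\ linear P, forall z, `|P z| <= K * `|z| &
    forall x, P (D x) = tau x].
Proof.
move=> fdY /linear_pack[{}D ->] /linear_pack[{}tau ->] hK h0 hD.
have [U [UU FU]] := ultraFilterLemma FF.
have ex z : exists l : Y, h_ i z @[i --> U] --> l.
  apply: (@fd_ultra_cvg _ _ _ _ _ _ (K * `|z|)) => // i.
  by have := hK i z 0; rewrite h0 !subr0.
have [h1 h1P] := choice ex.
have h1K : lip K h1.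
  move=> x y; apply: (cvg_normr_le (cvgB (h1P x) (h1P y))).
  by apply: nearW => i; exact: hK.
have h1D x : h1 (D x) = tau x.
  apply: (@cvg_unique _ (@norm_hausdorff _ Y) (h_ i (D x) @[i --> U])) => //.
    exact: h1P.
  by move=> B nB; apply: FU; exact: (hD x B nB).
pose W := range D.
have W0 : W 0 by exists 0 => //; rewrite linear0.
have WD x y : W x -> W y -> W (x + y).
  by move=> [u _ <-] [v _ <-]; exists (u + v) => //; rewrite linearD.
(* [h1] is additive on the range of [D], so the first mean keeps its values there. The increments of
   [h2] along the range are the same at all points of [G], so the second mean, over [G], keeps these
   values too. *)
have [h2 [h2K h2D h2E]] := lip_invariant_mean fdY W0 WD h1K.
have [h3 [h3K h3D h3E]] :=
  @lip_invariant_mean _ _ _ K setT h2 fdY Logic.I (fun _ _ _ _ => Logic.I) h2K.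
have h3DD x y : h3 (x + y) = h3 x + h3 y by exact: h3D.
exists h3; split.
- exact: additive_lip_linear h3K h3DD.
- have h30 : h3 0 = 0 by apply: (addIr (h3 0)); rewrite -h3DD !add0r.
  by move=> z; have := h3K z 0; rewrite h30 !subr0.
- move=> x; have DxW : W (D x) by exists x.
  have -> : h3 (D x) = h2 (D x).
    by apply: h3E => y _; rewrite h2D// addrC addKr.
  by apply: h2E => _ [y _ <-]; rewrite -linearD !h1D linearD addrC addKr.
Qed.

Section DifferenceQuotient.
Context {R : realType} {V G : normedModType R}.

Definition diff_quot (f : V -> G) (x0 : V) (t : R) (x : V) : G :=
  t^-1 *: (f (x0 + t *: x) - f x0).

Lemma diff_quot_lip K f x0 t : 0 <= K -> lip K f -> lip K (diff_quot f x0 t).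
Proof.
move=> K0 fK x y; rewrite /diff_quot -scalerBr opprB addrA subrK normrZ.
(* At [t = 0] the quotient vanishes because [0^-1 = 0], so the bound holds for every [t]. *)
have [->|t0] := eqVneq t 0; first by rewrite invr0 normr0 mul0r mulr_ge0.
rewrite normfV ler_pdivrMl ?normr_gt0// (le_trans (fK _ _))//.
by rewrite opprD addrACA subrr add0r -scalerBr normrZ mulrCA.
Qed.

End DifferenceQuotient.

(** [ideal_limit] bounds the ideal norm of the derivative [D], and [linear_lip_extension] gives a
    linear [P] such that [P \o D] is the composite. *)
Lemma ideal_norm_lip_factor (R : realType) (A : banachIdeal R)
    (M G1 G2 Y : completeNormedModType R) (S : G1 -> G2)
    (g : M -> G1) (h : G2 -> Y) (K1 K2 : R) (x0 : M) :
  finite_dim M -> finite_dim Y -> 0 <= K1 -> 0 <= K2 ->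
  lip K1 g -> lip K2 h -> ideal_mem A S -> linear (h \o S \o g) ->
  gateaux_differentiable (S \o g) x0 ->
  ideal_norm A (h \o S \o g) <= K2 * (ideal_norm A S * K1).
Proof.
move=> fdM fdY K10 K20 gK hK AS ltau [D [bD DP]].
have [lD _] := bD.
have [lS [CS SCS]] := ideal_bounded AS.
have dqP x t : S (diff_quot g x0 t x) = diff_quot (S \o g) x0 t x.
  by have /linear_pack[L ->] := lS; rewrite linearZ linearB.
have [AD nD] : ideal_mem A D /\ ideal_norm A D <= ideal_norm A S * K1.
  apply: (@ideal_limit _ _ _ _ _ _ _ ((0 : R)^') _ (diff_quot g x0)) => //.
  - by move=> t; exact: diff_quot_lip.
  - by move=> x; under eq_fun do rewrite dqP; exact: DP.
pose p := S (g x0).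
have hD x : diff_quot h p t (D x) @[t --> (0 : R)^'] --> (h \o S \o g) x.
  have /linear_pack[tau tauE] := ltau.
  apply/cvgrPdist_lt => e e0.
  have K21 : 0 < K2 + 1 by rewrite ltr_wpDl.
  have /cvgrPdist_lt/(_ _ (divr_gt0 e0 K21)) d1 := DP x.
  have d2 := nbhs_dnbhs_neq (0 : R).
  apply: filterS2 d2 d1 => t /= t0 dt.
  (* The quotient of [h] along that of [S \o g] is the quotient of the linear composite, hence exact
     for each nonzero [t]. Replacing the inner quotient by [D x] costs at most [K2] times its
     error. *)
  have -> : h (S (g x)) = diff_quot h p t (diff_quot (S \o g) x0 t x).
    rewrite /diff_quot scalerA mulfV// scale1r /p /= [S (g x0) + _]addrC subrK.
    have hE y : h (S (g y)) = tau y by rewrite -tauE.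
    rewrite !hE (linearD tau) [tau x0 + _]addrC addrK.
    by rewrite linearZ scalerA mulVf// scale1r.
  rewrite (le_lt_trans (diff_quot_lip p t K20 hK _ _))//.
  move: dt; rewrite ltr_pdivlMr// distrC => dt.
  by rewrite (le_lt_trans _ dt)// mulrC ler_wpM2l// lerDl.
have h0 t : diff_quot h p t 0 = 0.
  by rewrite /diff_quot scaler0 addr0 subrr scaler0.
have [P [lP PK PD]] := linear_lip_extension fdY lD ltau
  (fun t => diff_quot_lip p t K20 hK) h0 hD.
have lid : linear (@idfun M) by [].
have idb x : `|@idfun M x| <= 1 * `|x| by rewrite mul1r.
have [_] := ideal_comp_bound K20 ler01 lP lid PK idb AD.
rewrite mulr1 (_ : P \o D \o idfun = h \o S \o g); last by apply/funext => x; exact: PD.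
by move=> /le_trans; apply; rewrite ler_wpM2l.
Qed.

(** * Reduction of the theorem to finite dimension *)

Lemma sub_space_finite_dim (R : realType) (E : normedModType R)
    (M : fdSubspace E) : finite_dim (sub_space M).
Proof.
have [n [b bM]] := fdsub_span M.
have bi i : b i \in csub M.
  apply/bM; exists (fun j => (j == i)%:R).
  rewrite (bigD1 i)//= eqxx scale1r big1 ?addr0// => j /negbTE ->.
  by rewrite scale0r.
exists n, (fun i => SubSpace (bi i)) => v; have /bM[c vc] := sub_inclP v.
exists c; apply: val_inj; rewrite /= vc.
elim/big_ind2 : _ => //.
by move=> x1 x2 y1 y2 -> ->.
Qed.

Unset Implicit Arguments.
Set Strict Implicit.

Theorem theorem4p11 (R : realType) (E F : completeNormedModType R)
    (A : banachIdeal R) (T : E -> F) (hT : bounded_linear T)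
    (G1 G2 : completeNormedModType R)
    (f1 : E -> G1) (f2 : G2 -> F) (S : G1 -> G2)
    (hf1 : lipschitz f1) (hf2 : lipschitz f2)
    (hS : ideal_mem A S)
    (hfact : T = f2 \o S \o f1)
    (hmax : maximal_ideal A)
    (hdiff : forall M H : completeNormedModType R, finite_dim M ->
       forall f : M -> H, lipschitz f -> ideal_Lip0 A f ->
         exists x0 : M, gateaux_differentiable f x0) :
  ideal_mem A T.
Proof.
have [K1 K10 f1K] := lipschitz_lip hf1.
have [K2 K20 f2K] := lipschitz_lip hf2.
apply/(hmax E F).1; split => //.
(* The bound does not depend on the subspaces [M] and [L], so the supremum is finite. *)
apply: (@le_lt_trans _ _ (K2 * (ideal_norm A S * K1))%:E); last exact: ltry.
apply: ge_ereal_sup => _ [M [L [fdL ->]]]; rewrite lee_fin.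
have [lS [CS SCS]] := ideal_bounded hS.
have [lT _] := hT.
have fdM := sub_space_finite_dim M.
(* [g] must vanish at 0 for [Lip0]; since [S] is linear, the constant removed here is restored
   inside [h]. *)
pose g (x : sub_space M) := f1 (sub_incl x) - f1 (sub_incl (0 : sub_space M)).
pose h z := quot_map L (f2 (z + S (f1 (sub_incl (0 : sub_space M))))).
have gK : lip K1 g.
  by move=> x y; rewrite /g opprB addrA subrK; exact: f1K.
have qB x y : quot_map L (x - y) = quot_map L x - quot_map L y.
  by rewrite quot_mapD -scaleN1r quot_mapZ scaleN1r.
have hK : lip K2 h.
  move=> x y; rewrite /h -qB (le_trans (quot_map_norm_le _ _))//.
  by rewrite (le_trans (f2K _ _))// opprD addrACA subrr addr0.
have fE : @quot_map _ _ L \o T \o @sub_incl _ _ M = h \o S \o g.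
  apply/funext => x; rewrite /h /g hfact /=.
  by have /linear_pack[P ->] := lS; rewrite linearB subrK.
rewrite fE.
have ltau : linear (h \o S \o g).
  rewrite -fE => a x y /=.
  by rewrite lT quot_mapD quot_mapZ.
have SgK : lip (`|CS| * K1) (S \o g).
  move=> x y /=; have /linear_pack[P PE] := lS.
  rewrite PE -linearB -PE (le_trans (SCS _))//.
  rewrite (le_trans (ler_wpM2r (normr_ge0 _) (ler_norm CS)))// -mulrA.
  exact: ler_wpM2l.
have [x0 dx0] : exists x0, gateaux_differentiable (S \o g) x0.
  apply: hdiff => //; first exact: lip_lipschitz SgK.
  exists G1, g, S; split => //; split; first exact: lip_lipschitz gK.
  by rewrite /g subrr.
exact: ideal_norm_lip_factor dx0.
Qed.
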